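(* Let $\mathcal B=(X,Y,Z)$ be a bilinear triple of Banach spaces, let $f\in(\mathcal B)G([a,b],X)$ (i.e. $f:[a,b]\to X$ is simply-regulated) and let $g:[a,b]\to Y$. Let $T$ be a closed subset of $[a,b]$ and suppose $$S:=[a,b]\setminus T=\bigcup_{i\in\mathbb N}E_i,$$ where $E_i$, $i\in\mathbb N$, are mutually disjoint elementary sets in $[a,b]$. Put $S_n=\bigcup_{i=1}^nE_i$ for $n\in\mathbb N$. Assume that the integral $\int_T[\mathrm df]\,g$ exists and that the sequence $\{g\chi_{S_n}\}_{n\in\mathbb N}$ is equi-integrable with respect to $f$ on $[a,b]$. Then the integrals $\int_S[\mathrm df]\,g$, $\int_{[a,b]}[\mathrm df]\,g$ and $\int_{E_i}[\mathrm df]\,g$ for all $i\in\mathbb N$ exist. Moreover, $$\int_{[a,b]}[\mathrm df]\,g=\int_T[\mathrm df]\,g+\int_S[\mathrm df]\,g,\qquad\text{where}\qquad \int_S[\mathrm df]\,g=\sum_{i=1}^\infty\int_{E_i}[\mathrm df]\,g .$$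
   Context: $[a,b]$ is a fixed compact interval in $\mathbb R$, $a<b$. A bilinear triple $\mathcal B=(X,Y,Z)$ consists of Banach spaces $X,Y,Z$ together with a bilinear map $B:X\times Y\to Z$, written $xy:=B(x,y)$, such that $\|xy\|_Z\le\beta\|x\|_X\|y\|_Y$ for some $\beta\in[0,\infty)$ (without loss of generality $\beta=1$). A function $h:[a,b]\to Z$ is regulated if it has a one-sided limit in $Z$ from the right at each point of $[a,b)$ and from the left at each point of $(a,b]$. A function $f:[a,b]\to X$ is simply-regulated ($f\in(\mathcal B)G([a,b],X)$) if for every $y\in Y$ the function $t\mapsto f(t)y\in Z$ is regulated on $[a,b]$. An elementary set is a finite union of mutually disjoint bounded intervals in $\mathbb R$. A gauge on $[a,b]$ is a function $\delta:[a,b]\to(0,\infty)$. A tagged partition $P=\{([\alpha_{j-1},\alpha_j],\xi_j)\}_{j=1}^m$ of $[a,b]$ consists of $a=\alpha_0<\alpha_1<\dots<\alpha_m=b$ and $\xi_j\in[\alpha_{j-1},\alpha_j]$; it is $\delta$-fine if $[\alpha_{j-1},\alpha_j]\subset(\xi_j-\delta(\xi_j),\xi_j+\delta(\xi_j))$ for all $j$. For $f:[a,b]\to X$, $g:[a,b]\to Y$ put $S(\mathrm df,g,P)=\sum_{j=1}^m[f(\alpha_j)-f(\alpha_{j-1})]\,g(\xi_j)$. The Kurzweil-Stieltjes integral $\int_a^b[\mathrm df]\,g$ exists and equals $I\in Z$ if for every $\varepsilon>0$ there is a gauge $\delta$ on $[a,b]$ such that $\|S(\mathrm df,g,P)-I\|_Z<\varepsilon$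 for every $\delta$-fine partition $P$ of $[a,b]$. For an arbitrary set $M\subset[a,b]$ with characteristic function $\chi_M$, $\int_M[\mathrm df]\,g:=\int_a^b[\mathrm df]\,(g\chi_M)$ whenever the right-hand side exists. A sequence $\{g_n\}$ of functions $[a,b]\to Y$ is equi-integrable with respect to $f:[a,b]\to X$ on $[a,b]$ if $\int_a^b[\mathrm df]\,g_n$ exists for all $n\in\mathbb N$ and for every $\eta>0$ there is a gauge $\delta$ on $[a,b]$ such that $\big\|S(\mathrm df,g_n,P)-\int_a^b[\mathrm df]\,g_n\big\|_Z<\eta$ for every $\delta$-fine partition $P$ of $[a,b]$ and every $n\in\mathbb N$. *)

(* Defs.v *)
From HB Require Import structures.
From mathcomp Require Import all_boot all_order all_algebra.
From mathcomp Require Import all_classical all_reals all_analysis.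
Set Implicit Arguments.
Unset Strict Implicit.
Unset Printing Implicit Defensive.
Import Order.TTheory GRing.Theory Num.Theory.
Import numFieldNormedType.Exports.
Local Open Scope classical_set_scope.
Local Open Scope ring_scope.

(* Functions on [a, b] are represented by total functions on R; every notion
   below depends only on their values on [a, b]. *)

Definition bounded_bilinear (R : realType) (X Y Z : normedModType R)
    (B : X -> Y -> Z) : Prop :=
  exists2 beta : R, 0 <= beta & forall x y, `|B x y| <= beta * `|x| * `|y|.

Definition regulated (R : realType) (Z : normedModType R) (a b : R)
    (h : R -> Z) : Prop :=
  (forall t, a <= t < b -> cvg (h @ t^'+)) /\
  (forall t, a < t <= b -> cvg (h @ t^'-)).

Definition simply_regulated (R : realType) (X Y Z : normedModType R)
    (B : X -> Y -> Z) (a b : R) (f : R -> X) : Prop :=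
  forall y : Y, regulated a b (fun t => B (f t) y).

Definition elementary_set (R : realType) (E : set R) : Prop :=
  exists (n : nat) (J : nat -> set R),
    [/\ forall k, (k < n)%N -> is_interval (J k) /\ bounded_set (J k),
        trivIset `I_n J
      & E = \bigcup_(k < n) J k].

Definition gauge (R : realType) (a b : R) (delta : R -> R) : Prop :=
  forall t, t \in `[a, b] -> 0 < delta t.

(* The division points are alpha_0 = a and alpha_j = s_(j-1) for
   1 <= j <= size s; the tag of [alpha_j, alpha_(j+1)] is xi j, and the values
   of xi beyond size s are irrelevant. *)
Definition div_point (R : realType) (a : R) (s : seq R) (j : nat) : R :=
  nth a (a :: s) j.

Definition tagged_partition (R : realType) (a b : R) (s : seq R)
    (xi : nat -> R) : Prop :=
  itv_partition a b s /\
  forall j, (j < size s)%N ->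
    xi j \in `[div_point a s j, div_point a s j.+1].

Definition delta_fine (R : realType) (a : R) (delta : R -> R) (s : seq R)
    (xi : nat -> R) : Prop :=
  forall j, (j < size s)%N ->
    `[div_point a s j, div_point a s j.+1] `<=`
    `](xi j - delta (xi j)), (xi j + delta (xi j))[.

Definition KS_sum (R : realType) (X Y Z : normedModType R) (B : X -> Y -> Z)
    (a : R) (f : R -> X) (g : R -> Y) (s : seq R) (xi : nat -> R) : Z :=
  \sum_(j < size s)
    B (f (div_point a s j.+1) - f (div_point a s j)) (g (xi j)).

Definition is_KS_integral (R : realType) (X Y Z : normedModType R)
    (B : X -> Y -> Z) (a b : R) (f : R -> X) (g : R -> Y) (I : Z) : Prop :=
  forall eps : R, 0 < eps ->
    exists2 delta : R -> R, gauge a b delta &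
      forall s xi, tagged_partition a b s xi -> delta_fine a delta s xi ->
        `|KS_sum B a f g s xi - I| < eps.

Definition KS_integrable (R : realType) (X Y Z : normedModType R)
    (B : X -> Y -> Z) (a b : R) (f : R -> X) (g : R -> Y) : Prop :=
  exists I : Z, is_KS_integral B a b f g I.

(* The value is unique when a < b and the integral exists; otherwise it is
   meaningless (0 when no value exists). *)
Definition KS_integral (R : realType) (X Y Z : normedModType R)
    (B : X -> Y -> Z) (a b : R) (f : R -> X) (g : R -> Y) : Z :=
  xget 0 [set I | is_KS_integral B a b f g I].

Definition mul_indic (R : realType) (Y : normedModType R) (g : R -> Y)
    (M : set R) : R -> Y :=
  fun t => \1_M t *: g t.

Definition KS_integrable_on (R : realType) (X Y Z : normedModType R)
    (B : X -> Y -> Z) (a b : R) (f : R -> X) (g : R -> Y) (M : set R) : Prop :=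
  KS_integrable B a b f (mul_indic g M).

Definition KS_integral_on (R : realType) (X Y Z : normedModType R)
    (B : X -> Y -> Z) (a b : R) (f : R -> X) (g : R -> Y) (M : set R) : Z :=
  KS_integral B a b f (mul_indic g M).

Definition equi_integrable (R : realType) (X Y Z : normedModType R)
    (B : X -> Y -> Z) (a b : R) (f : R -> X) (g : nat -> R -> Y) : Prop :=
  (forall n, KS_integrable B a b f (g n)) /\
  forall eta : R, 0 < eta ->
    exists2 delta : R -> R, gauge a b delta &
      forall s xi, tagged_partition a b s xi -> delta_fine a delta s xi ->
        forall n, `|KS_sum B a f (g n) s xi - KS_integral B a b f (g n)| < eta.

(* Main.v *)
(* The functions [g chi_(S_n)] agree with [g chi_S] at each point for large n.
   A fixed delta-fine partition has finitely many tags, so its sums for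
   [g chi_(S_n)] eventually equal its sum for [g chi_S].  With the gauge given
   by equi-integrability, the integrals over S_n are therefore eventually close
   to that single sum, so they form a Cauchy sequence whose limit is the
   integral over S.  The rest is linearity and uniqueness of the integral. *)
Require Import Defs.
From HB Require Import structures.
From mathcomp Require Import all_boot all_order all_algebra.
From mathcomp Require Import all_classical all_reals all_analysis.
From mathcomp Require Import lra.
Set Implicit Arguments.
Unset Strict Implicit.
Unset Printing Implicit Defensive.
Import Order.TTheory GRing.Theory Num.Theory.
Import numFieldNormedType.Exports.
Local Open Scope classical_set_scope.
Local Open Scope ring_scope.

Lemma div_point_rcons (R : realType) (a y : R) (s : seq R) (j : nat) :
  (j <= size s)%N -> div_point a (rcons s y) j = div_point a s j.
Proof. by move=> js; rewrite /div_point -rcons_cons nth_rcons /= ltnS js. Qed.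

Lemma div_point_last (R : realType) (a b : R) (s : seq R) :
  itv_partition a b s -> div_point a s (size s) = b.
Proof. exact: itv_partition_nth_size. Qed.

Lemma tagged_partition_extend (R : realType) (a x y t : R) (s : seq R)
    (xi : nat -> R) (d : R -> R) :
  x < y -> t \in `[x, y] ->
  `[x, y] `<=` `](t - d t), (t + d t)[ ->
  tagged_partition a x s xi -> delta_fine a d s xi ->
  exists s' xi', tagged_partition a y s' xi' /\ delta_fine a d s' xi'.
Proof.
move=> xy txy fxy [ps pxi] fs.
have lx := div_point_last ps.
have ly : div_point a (rcons s y) (size s).+1 = y.
  by rewrite /div_point /= nth_rcons ltnn eqxx.
(* The appended interval has index [size s], from which on the values of [xi] were arbitrary, so
   they can be reset to [t]. *)
exists (rcons s y), (fun j => if (j < size s)%N then xi j else t).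
split; first split.
- by rewrite -cats1; apply: itv_partition_cat ps (itv_partition1 xy).
- move=> j; rewrite size_rcons ltnS leq_eqVlt => /predU1P[->|js].
    by rewrite ltnn ly div_point_rcons// lx.
  by rewrite js !div_point_rcons ?(ltnW js)//; apply: pxi.
- move=> j; rewrite size_rcons ltnS leq_eqVlt => /predU1P[->|js].
    by rewrite ltnn ly div_point_rcons// lx.
  by rewrite js !div_point_rcons ?(ltnW js)//; apply: fs.
Qed.

(** Supremum argument: let [c] be the supremum of the points reachable from [a] by a fine partition.
    The gauge at [c] covers a neighbourhood of [c], so one more interval tagged at [c] shows that
    [c] itself is reachable, and another would pass beyond [c] if [c < b]. *)
Lemma cousin (R : realType) (a b : R) (d : R -> R) :
  a <= b -> gauge a b d ->
  exists s xi, tagged_partition a b s xi /\ delta_fine a d s xi.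
Proof.
move=> ab dpos.
pose A := [set x | a <= x <= b /\
  exists s xi, tagged_partition a x s xi /\ delta_fine a d s xi].
have Aa : A a.
  split; first by rewrite lexx.
  by exists [::], (fun=> a); split => //; split => //; split.
have ubA : has_ubound A by exists b => x [/andP[]].
have supA : has_sup A by split => //; exists a.
pose c := sup A.
have ac : a <= c by apply: ub_le_sup.
have cb : c <= b by apply: ge_sup => [|x [/andP[]]//]; exists a.
have dc : 0 < d c by apply: dpos; rewrite in_itv/= ac.
(* The added interval [[x, y]] always has tag [c]. This is used twice: with [y = c] to reach the
   supremum, and with [x = c] to step past it. *)
have extend x y : A x -> x < y <= b -> c - d c < x <= c -> c <= y < c + d c ->
    A y.
  move=> [/andP[ax xb] [s [xi [ps fs]]]] /andP[xy yb] /andP[dx xc] /andP[cy yd].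
  split; first by rewrite yb (le_trans ax (ltW xy)).
  apply: (tagged_partition_extend xy _ _ ps fs (t := c)) => //.
    by rewrite in_itv/= xc.
  by move=> z; rewrite /= !in_itv/= => /andP[xz zy]; apply/andP; split; lra.
have [x Ax dx] := sup_adherent dc supA; rewrite -/c in dx.
have xc : x <= c by exact: ub_le_sup.
have Ac : A c.
  have [<-//|xNc] := eqVneq x c.
  have lt_xc : x < c by rewrite lt_neqAle xNc.
  by apply: (extend x) => //; rewrite ?lt_xc ?dx ?lexx// ltrDl.
have [cb'|cNb] := eqVneq c b; first by move: Ac => []; rewrite cb'.
have lt_cb : c < b by rewrite lt_neqAle cNb.
(* Halving keeps [y] strictly within reach of the tag [c], and the minimum keeps it in [[a, b]];
   then [A y] and [c < y] contradict the choice of [c]. *)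
pose y := Num.min b (c + d c / 2).
have cy : c < y by rewrite lt_min lt_cb ltrDl divr_gt0.
have yd : y < c + d c by rewrite gt_min; apply/orP; right; lra.
have : A y.
  apply: (extend c) => //; rewrite ?cy ?yd ?lexx ?(ltW cy)//.
  - by rewrite ge_min lexx.
  - by rewrite andbT; lra.
by move=> /(ub_le_sup ubA); rewrite -/c leNgt cy.
Qed.

Lemma gaugeI (R : realType) (a b : R) (d1 d2 : R -> R) :
  gauge a b d1 -> gauge a b d2 -> gauge a b (fun t => Num.min (d1 t) (d2 t)).
Proof. by move=> h1 h2 t tab; rewrite lt_min h1 ?h2. Qed.

Lemma delta_fineS (R : realType) (a : R) (d1 d2 : R -> R) (s : seq R)
    (xi : nat -> R) :
  (forall t, d1 t <= d2 t) -> delta_fine a d1 s xi -> delta_fine a d2 s xi.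
Proof.
move=> d12 h j js x /(h j js); rewrite /= !in_itv/= => /andP[h1 h2].
by have d12j := d12 (xi j); apply/andP; split; lra.
Qed.

Section KS_linear.
Context {R : realType} {X Y Z : normedModType R}.
Variables (B : {bilinear X -> Y -> Z}) (a b : R) (f : R -> X).
Implicit Types (g h : R -> Y) (I J : Z).

Lemma KS_sumD g h s xi :
  KS_sum B a f (fun t => g t + h t) s xi =
  KS_sum B a f g s xi + KS_sum B a f h s xi.
Proof.
by rewrite /KS_sum -big_split; apply: eq_bigr => j _; rewrite linearDr.
Qed.

Lemma KS_sumN g s xi :
  KS_sum B a f (fun t => - g t) s xi = - KS_sum B a f g s xi.
Proof. by rewrite /KS_sum -sumrN; apply: eq_bigr => j _; rewrite linearNr. Qed.

Lemma is_KS_integralD g h I J :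
  is_KS_integral B a b f g I -> is_KS_integral B a b f h J ->
  is_KS_integral B a b f (fun t => g t + h t) (I + J).
Proof.
move=> gI hJ e e0; have e20 : 0 < e / 2 by rewrite divr_gt0.
have [d1 d1g h1] := gI _ e20; have [d2 d2g h2] := hJ _ e20.
exists (fun t => Num.min (d1 t) (d2 t)); first exact: gaugeI.
move=> s xi ps fs; rewrite KS_sumD opprD addrACA (splitr e).
apply: le_lt_trans (ler_normD _ _) (ltrD _ _).
- by apply: h1 => //; apply: delta_fineS fs => t; rewrite ge_min lexx.
- by apply: h2 => //; apply: delta_fineS fs => t; rewrite ge_min lexx orbT.
Qed.

Lemma is_KS_integralN g I :
  is_KS_integral B a b f g I -> is_KS_integral B a b f (fun t => - g t) (- I).
Proof.
move=> gI e /gI[d dg h]; exists d => // s xi ps fs.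
by rewrite KS_sumN -opprD normrN; apply: h.
Qed.

(** By linearity [I - J] is an integral of [g - g], all of whose sums vanish. Cousin's lemma
    provides a fine partition on which to read this off; without one the defining condition would be
    vacuous. *)
Lemma is_KS_integral_unique g I J : a <= b ->
  is_KS_integral B a b f g I -> is_KS_integral B a b f g J -> I = J.
Proof.
move=> ab gI gJ; apply/eqP; rewrite -subr_eq0 -normr_eq0.
rewrite eq_le normr_ge0 andbT; apply/ler_addgt0Pr => e e0.
have [d dg h] := is_KS_integralD gI (is_KS_integralN gJ) e0.
have [s [xi [ps fs]]] := cousin ab dg.
rewrite add0r -normrN ltW//; have := h s xi ps fs.
by rewrite KS_sumD KS_sumN subrr sub0r.
Qed.

Lemma KS_integralP g :
  KS_integrable B a b f g -> is_KS_integral B a b f g (KS_integral B a b f g).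
Proof. by move=> gI; apply: xgetPex. Qed.

Lemma is_KS_integral_eq g I : a <= b ->
  is_KS_integral B a b f g I -> KS_integral B a b f g = I.
Proof.
move=> ab gI; apply: (is_KS_integral_unique ab _ gI).
by apply: KS_integralP; exists I.
Qed.

End KS_linear.

(** The threshold for [n] may vary with [t]: a sum sees only finitely many tags, and a finite
    intersection of eventual properties is eventual. *)
Lemma near_KS_sum_eq (R : realType) (X Y Z : normedModType R)
    (B : X -> Y -> Z) (a : R) (f : R -> X) (gn : nat -> R -> Y) (h : R -> Y)
    (s : seq R) (xi : nat -> R) :
  (forall t, \forall n \near \oo, gn n t = h t) ->
  \forall n \near \oo, KS_sum B a f (gn n) s xi = KS_sum B a f h s xi.
Proof.
move=> gh.
have : \forall n \near \oo, forall j : 'I_(size s), gn n (xi j) = h (xi j).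
  by apply: filter_forall => j; apply: gh.
by apply: filterS => n gnh; apply: eq_bigr => j _; rewrite gnh.
Qed.

Lemma equi_integrable_cvg (R : realType) (X Y : normedModType R)
    (Z : completeNormedModType R) (B : {bilinear X -> Y -> Z}) (a b : R)
    (f : R -> X) (gn : nat -> R -> Y) (h : R -> Y) :
  a <= b -> equi_integrable B a b f gn ->
  (forall t, \forall n \near \oo, gn n t = h t) ->
  exists2 I, is_KS_integral B a b f h I &
    KS_integral B a b f (gn n) @[n --> \oo] --> I.
Proof.
move=> ab [_ equi] gh; pose I n := KS_integral B a b f (gn n).
(* The gauge is chosen before [n], thanks to equi-integrability; only the threshold for [n] depends
   on the partition. *)
have near_I e : 0 < e -> exists2 d : R -> R, gauge a b d &
    forall s xi, tagged_partition a b s xi -> delta_fine a d s xi ->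
      \forall n \near \oo, `|KS_sum B a f h s xi - I n| < e.
  move=> /equi[d dg H]; exists d => // s xi ps fs.
  apply: filterS (near_KS_sum_eq B a f s xi gh) => n <-.
  exact: H.
have cI : cvg (I n @[n --> \oo]).
  (* For each radius it is enough to find one ball containing the tail; its centre is the sum over a
     single fine partition. Completeness of [Z] then yields the limit. *)
  apply: cauchy_cvg; apply: cauchy_exP => e e0.
  have [d dg H] := near_I _ e0.
  have [s [xi [ps fs]]] := cousin ab dg.
  exists (KS_sum B a f h s xi).
  by apply: filterS (H s xi ps fs) => n; rewrite -ball_normE.
exists (lim (I n @[n --> \oo])) => // e e0.
have [d dg H] := near_I _ (divr_gt0 e0 (ltr0Sn _ 1)).
exists d => // s xi ps fs.
(* Passing to the limit in [n] keeps only a non-strict bound, hence the margin [e / 2]. *)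
apply: (@le_lt_trans _ _ (e / 2)); last by lra.
have cS : `|KS_sum B a f h s xi - I n| @[n --> \oo] -->
    `|KS_sum B a f h s xi - lim (I n @[n --> \oo])|.
  by apply: cvg_norm; apply: cvgB => //; apply: cvg_cst.
rewrite -(cvg_lim _ cS)//; apply: limr_le.
  by apply/cvg_ex; eexists; exact: cS.
by apply: filterS (H s xi ps fs) => n /ltW.
Qed.

Lemma mul_indicU (R : realType) (Y : normedModType R) (g : R -> Y)
    (M N : set R) : [disjoint M & N] ->
  mul_indic g (M `|` N) = fun t => mul_indic g M t + mul_indic g N t.
Proof.
move=> /disj_setPS MN; apply/funext => t; rewrite /mul_indic !indicE in_setU.
have [tM|_] := boolP (t \in M); have [tN|_] := boolP (t \in N);
  rewrite ?scale1r ?scale0r ?addr0 ?add0r//.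
by have := MN t; rewrite !inE in tM tN; case; split.
Qed.

Theorem theorem5p3 (R : realType) (X Y Z : completeNormedModType R)
    (B : {bilinear X -> Y -> Z}) (hB : bounded_bilinear B)
    (a b : R) (hab : a < b)
    (f : R -> X) (hf : simply_regulated B a b f) (g : R -> Y)
    (T : set R) (hTab : T `<=` `[a, b]) (hT : closed T)
    (E : nat -> set R)
    (hEab : forall i, E i `<=` `[a, b])
    (hEel : forall i, elementary_set (E i))
    (hEdisj : trivIset setT E)
    (hS : `[a, b] `\` T = \bigcup_i E i)
    (hintT : KS_integrable_on B a b f g T)
    (hequi : equi_integrable B a b f
               (fun n => mul_indic g (\bigcup_(i < n.+1) E i))) :
  let S := `[a, b] `\` T in
  [/\ KS_integrable_on B a b f g S,
      KS_integrable_on B a b f g `[a, b],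
      forall i, KS_integrable_on B a b f g (E i),
      KS_integral_on B a b f g `[a, b] =
        KS_integral_on B a b f g T + KS_integral_on B a b f g S
    & series (fun i => KS_integral_on B a b f g (E i)) @ \oo -->
        KS_integral_on B a b f g S].
Proof.
move=> S; set Sn := fun n => \bigcup_(i < n.+1) E i.
have le_ab := ltW hab.
have SnS n : Sn n.+1 = Sn n `|` E n.+1.
  by rewrite /Sn !bigcup_mkord big_ord_recr.
have disjSn n : [disjoint Sn n & E n.+1].
  apply/disj_setPS => t [[i /= ni Eit] Ent].
  have := hEdisj i n.+1 I I; rewrite -ltnS in ni *.
  by move=> /(_ (ex_intro _ t (conj Eit Ent))) ein; rewrite ein ltnn in ni.
(* If [t] lies in [E i], equality holds from [n = i] on; if [t] is outside [S], both sides vanish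
   for every [n]. *)
have ev_eq t : \forall n \near \oo, mul_indic g (Sn n) t = mul_indic g S t.
  have [St|NSt] := pselect (S t).
    have [i _ Eit] : (\bigcup_i E i) t by rewrite -hS.
    near=> n; rewrite /mul_indic !indicE !mem_set//.
    by exists i => //=; rewrite ltnS; near: n; exact: nbhs_infty_ge.
  near=> n; rewrite /mul_indic !indicE !memNset// => -[i _ Eit].
  by apply: NSt; rewrite /S hS; exists i.
have [IS intS cvgS] := equi_integrable_cvg le_ab hequi ev_eq.
have intSn n := KS_integralP (hequi.1 n).
(* As [E n.+1] is the difference of consecutive [Sn], linearity gives both its integrability and its
   integral as a telescoping term. *)
have gES n : mul_indic g (E n.+1) =
    fun t => mul_indic g (Sn n.+1) t + - mul_indic g (Sn n) t.
  apply/funext => t; rewrite SnS (mul_indicU _ (disjSn n)).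
  by rewrite addrAC subrr add0r.
have Sn0 : Sn 0%N = E 0%N by rewrite /Sn bigcup_mkord big_ord1.
have intE n : is_KS_integral B a b f (mul_indic g (E n.+1))
    (KS_integral_on B a b f g (Sn n.+1) - KS_integral_on B a b f g (Sn n)).
  by rewrite gES; apply: is_KS_integralD (intSn _) (is_KS_integralN (intSn _)).
have intTS := is_KS_integralD (KS_integralP hintT) intS.
have gab : mul_indic g `[a, b] =
    fun t => mul_indic g T t + mul_indic g S t.
  rewrite -mul_indicU; first by rewrite /S setDUK.
  by apply/disj_setPS => t [Tt [_ /(_ Tt)]].
have ISE := is_KS_integral_eq le_ab intS.
split.
- by exists IS.
- by rewrite /KS_integrable_on gab; exists (KS_integral_on B a b f g T + IS).
- case=> [|n]; first by rewrite -Sn0; exact: hequi.1.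
  by eexists; exact: intE.
- by rewrite /KS_integral_on gab ISE; apply: is_KS_integral_eq.
(* The series at index [n] stops at [E n.-1], whereas [Sn n] includes [E n]; after a shift by one
   the partial sums telescope to the integrals over [Sn n]. *)
- rewrite [X in _ --> X]ISE -cvg_shiftS.
  suff -> : [sequence series (fun i => KS_integral_on B a b f g (E i)) n.+1]_n =
      fun n => KS_integral_on B a b f g (Sn n) by [].
  apply/funext; elim=> [|n IHn] /=; first by rewrite /series/= big_nat1 Sn0.
  rewrite /series/= in IHn *; rewrite big_nat_recr//= IHn.
  by rewrite [X in _ + X](is_KS_integral_eq le_ab (intE n)) addrC subrK.
Unshelve. all: by end_near. Qed.
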